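(* The composition map $\mathrm{Comp}^2:\mathcal{D}(\mathbb{R})\times\mathcal{D}(\mathbb{R})\to\mathcal{D}(\mathbb{R})$, $(\xi,\eta)\mapsto\xi\circ\eta$, is continuous.
   Context: $\mathcal{D}(\mathbb{R})$ is the set of maps $\eta:\mathbb{R}\to\mathbb{R}$ such that: (1) $\eta$ is $C^1$ with $a\le\eta'(x)\le b$ on $\mathbb{R}$ for some $0<a<b$ (depending on $\eta$); (2) $\int_{\mathbb{R}}|\eta(x)-x|^2dx<\infty$ and $\int_{\mathbb{R}}|\eta'(x)-1|^2dx<\infty$; (3) $\lim_{|x|\to\infty}\eta'(x)=1$. It is a group under composition. Its topology is given by the distance $D(\eta,\xi)=\|\eta-\xi\|_{1,1}$, where $\|u\|_{1,1}=\sup_{x}|u(x)|+\sup_{x}|u'(x)|+\left(\int_{\mathbb{R}}u(x)^2dx+\int_{\mathbb{R}}u'(x)^2dx\right)^{1/2}$; the product carries the product topology. *)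

(* Defs.v *)
From HB Require Import structures.
From mathcomp Require Import all_boot all_order all_algebra.
From mathcomp Require Import ring lra.
From mathcomp Require Import all_classical all_reals all_analysis measurable_realfun.
Set Implicit Arguments.
Unset Strict Implicit.
Unset Printing Implicit Defensive.
Import Order.TTheory GRing.Theory Num.Theory.
Import numFieldNormedType.Exports.

Local Open Scope classical_set_scope.
Local Open Scope ring_scope.

(* In [ring_scope] this notation otherwise denotes the derivative of a polynomial. *)
Local Notation "f ^` ()" := (derive1 f) : ring_scope.

Section definitions.
Context {R : realType}.
Notation mu := (@lebesgue_measure R).

Definition inD (eta : R -> R) : Prop :=
  [/\ (forall x, derivable eta x 1) /\ continuous eta^`(),
      exists a b : R, 0 < a /\ a < b /\ forall x, a <= eta^`() x <= b,
      (\int[mu]_x ((`|eta x - x| ^+ 2)%:E) < +oo)%E /\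
      (\int[mu]_x ((`|eta^`() x - 1| ^+ 2)%:E) < +oo)%E &
      eta^`() x @[x --> -oo] --> (1 : R) /\ eta^`() x @[x --> +oo] --> (1 : R)].

(* Valued in [\bar R] so that no supremum or integral takes a junk value; it is
   finite on the differences of elements of D(R), see [norm11_fin_num]. *)
Definition norm11 (u : R -> R) : \bar R :=
  (ereal_sup (range (fun x => `|u x|%:E)) +
   ereal_sup (range (fun x => `|u^`() x|%:E)) +
   (\int[mu]_x ((u x ^+ 2)%:E) + \int[mu]_x ((u^`() x ^+ 2)%:E)) `^ 2^-1)%E.

End definitions.

Section helpers.
Context {R : realType}.
Notation mu := (@lebesgue_measure R).
Implicit Types (u v f eta xi : R -> R).

Definition sqint f : \bar R := (\int[mu]_x ((f x ^+ 2)%:E))%E.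

(* The space where differences of elements of D(R) live. *)
Definition C1H1 u : Prop :=
  [/\ forall x, derivable u x 1, continuous u^`(),
      exists K, forall x, `|u^`() x| <= K,
      (sqint u < +oo)%E & (sqint u^`() < +oo)%E].

Lemma derivable_cont u : (forall x, derivable u x 1) -> continuous u.
Proof. by move=> du x; exact/differentiable_continuous/derivable1_diffP. Qed.

Lemma cont_meas f : continuous f -> measurable_fun setT f.
Proof. exact: continuous_measurable_fun. Qed.

Lemma meas_sq f : continuous f ->
  measurable_fun setT (fun x => (f x ^+ 2)%:E : \bar R).
Proof.
by move=> cf; apply/measurable_EFinP; apply: measurable_funX; exact: cont_meas.
Qed.

Lemma sqint_ge0 f : (0 <= sqint f)%E.
Proof. by apply: integral_ge0 => x _; rewrite lee_fin sqr_ge0. Qed.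

Lemma sqint_fin f : (sqint f < +oo)%E -> sqint f \is a fin_num.
Proof. by move=> foo; rewrite ge0_fin_numE // sqint_ge0. Qed.

Lemma sqint_lin_fin (c : R) (f g h : R -> R) :
  continuous f -> continuous g -> continuous h -> 0 <= c ->
  (forall x, h x ^+ 2 <= c * (f x ^+ 2) + c * (g x ^+ 2)) ->
  (sqint f < +oo)%E -> (sqint g < +oo)%E -> (sqint h < +oo)%E.
Proof.
move=> cf cg ch c0 hfg foo goo.
apply: (@le_lt_trans _ _ (c%:E * sqint f + c%:E * sqint g)%E).
  rewrite /sqint -ge0_integralZl_EFin //; last 2 first.
    by move=> x _; rewrite lee_fin sqr_ge0.
    exact: meas_sq.
  rewrite -ge0_integralZl_EFin //; last 2 first.
    by move=> x _; rewrite lee_fin sqr_ge0.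
    exact: meas_sq.
  rewrite -ge0_integralD //; last 4 first.
    by move=> x _; rewrite -EFinM lee_fin mulr_ge0 ?sqr_ge0.
    by apply: measurable_funeM; exact: meas_sq.
    by move=> x _; rewrite -EFinM lee_fin mulr_ge0 ?sqr_ge0.
    by apply: measurable_funeM; exact: meas_sq.
  apply: ge0_le_integral => //.
  - by move=> x _; rewrite lee_fin sqr_ge0.
  - exact: meas_sq.
  - by apply: emeasurable_funD; apply: measurable_funeM; exact: meas_sq.
  - by move=> x _; rewrite -!EFinM -EFinD lee_fin.
by rewrite lte_add_pinfty // lte_mul_pinfty // ?lee_fin ?sqint_fin.
Qed.

Lemma derive1D_ u v x : derivable u x 1 -> derivable v x 1 ->
  (u + v)^`() x = u^`() x + v^`() x.
Proof. by move=> ? ?; rewrite !derive1E deriveD. Qed.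

Lemma derive1N_ u x : derivable u x 1 -> (- u)^`() x = - u^`() x.
Proof. by move=> ?; rewrite !derive1E deriveN. Qed.

Lemma C1H1N u : C1H1 u -> C1H1 (- u).
Proof.
move=> [du cu [K uK] iu iu'].
have dE : (- u)^`() = - u^`() by apply/funext => x; rewrite derive1N_.
split; rewrite ?dE.
- by move=> x; apply: derivableN.
- by move=> x; apply: cvgN; exact: cu.
- by exists K => x; rewrite fctE normrN.
- by rewrite /sqint; under eq_integral do rewrite fctE sqrrN.
- by rewrite /sqint; under eq_integral do rewrite fctE sqrrN.
Qed.

Lemma C1H1D u v : C1H1 u -> C1H1 v -> C1H1 (u + v).
Proof.
move=> [du cu [K uK] iu iu'] [dv cv [L vL] iv iv'].
have dE : (u + v)^`() = u^`() + v^`() by apply/funext => x; rewrite derive1D_.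
have cu0 := derivable_cont du; have cv0 := derivable_cont dv.
have sq (a b : R) : (a + b) ^+ 2 <= 2 * a ^+ 2 + 2 * b ^+ 2.
  rewrite -subr_ge0 [X in 0 <= X](_ : _ = (a - b) ^+ 2); last by ring.
  exact: sqr_ge0.
split; rewrite ?dE.
- by move=> x; apply: derivableD.
- by move=> x; apply: cvgD; [exact: cu|exact: cv].
- by exists (K + L) => x; rewrite fctE (le_trans (ler_normD _ _)) ?lerD.
- apply: (@sqint_lin_fin 2 u v) => //.
  + by move=> x; apply: cvgD; [exact: cu0|exact: cv0].
  + by move=> x; rewrite fctE sq.
- apply: (@sqint_lin_fin 2 u^`() v^`()) => //.
  + by move=> x; apply: cvgD; [exact: cu|exact: cv].
  + by move=> x; rewrite fctE sq.
Qed.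

Lemma mvt u : (forall x, derivable u x 1) -> forall x y, x < y ->
  exists c, u y - u x = u^`() c * (y - x).
Proof.
move=> du x y xy.
have [||c _ ->] := @MVT R u u^`() x y xy; last by exists c.
- by move=> z _; rewrite derive1E; exact/derivableP.
- exact/continuous_subspaceT/derivable_cont.
Qed.

Lemma C1H1_bounded u : C1H1 u -> exists M, forall x, `|u x| <= M.
Proof.
move=> [du cu [K uK] iu _].
have cu0 := derivable_cont du.
pose I := fine (sqint u).
exists (K + 1 + I) => x.
have [//|uxM] := leP `|u x| (K + 1 + I); exfalso.
have I0 : 0 <= I by rewrite fine_ge0 ?sqint_ge0.
pose m := `|u x| - K.
have m1 : 1 + I < m by rewrite /m; lra.
have um y : y \in `[x, x + 1] -> m <= `|u y|.
  rewrite in_itv /= => /andP[]; rewrite le_eqVlt => /predU1P[<- _|xy yx1].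
    by rewrite /m; have := uK x; have := normr_ge0 (u^`() x); lra.
  have [c uc] := mvt du xy.
  have : `|u y - u x| <= K.
    rewrite uc normrM (@ger0_norm _ (y - x)); last by rewrite subr_ge0 ltW.
    rewrite -[leRHS]mulr1; apply: ler_pM => //; first by lra.
    lra.
  have := ler_distD (u y) (u x) 0; rewrite !subr0 distrC /m; lra.
pose J : set R := [set` `[x, x + 1]].
have mJ : measurable J by exact: measurable_itv.
have muJ : mu J = 1%:E.
  rewrite /J lebesgue_measure_itv /= lte_fin ltrDl ltr01.
  by rewrite -EFinB addrAC subrr add0r.
have : ((m ^+ 2)%:E <= sqint u)%E.
  apply: (@le_trans _ _ (\int[mu]_(y in J) (u y ^+ 2)%:E)%E); last first.
    apply: ge0_subset_integral => //; first exact: meas_sq.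
    by move=> y _; rewrite lee_fin sqr_ge0.
  apply: (@le_trans _ _ (\int[mu]_(y in J) (cst (m ^+ 2)%:E y))%E).
    by rewrite integral_cst // [X in (_ * X)%E]muJ mule1.
  apply: ge0_le_integral => //.
  - by move=> y _; rewrite /= lee_fin sqr_ge0.
  - by apply: measurable_funTS; exact: meas_sq.
  - move=> y yx; rewrite lee_fin -(real_normK (num_real (u y))).
    by rewrite lerXn2r ?nnegrE ?um //; lra.
rewrite -(fineK (sqint_fin iu)) lee_fin -/I => mI.
have : m * 1 <= m * m by rewrite ler_wpM2l //; lra.
by rewrite -expr2 mulr1; lra.
Qed.

Definition supn u : \bar R := ereal_sup (range (fun x => `|u x|%:E)).

Lemma supn_ge0 u : (0 <= supn u)%E.
Proof.
apply: (@le_trans _ _ `|u 0|%:E); first by rewrite lee_fin.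
by apply: ereal_sup_ubound; exists 0.
Qed.

Lemma supn_fin u K : (forall x, `|u x| <= K) -> supn u \is a fin_num.
Proof.
move=> uK; rewrite ge0_fin_numE ?supn_ge0 //.
apply: (@le_lt_trans _ _ K%:E); last exact: ltry.
by apply: ge_ereal_sup => _ [x _ <-]; rewrite lee_fin.
Qed.

Lemma supnD u v : (supn (u + v)%R <= supn u + supn v)%E.
Proof.
apply: ge_ereal_sup => _ [x _ <-].
apply: (@le_trans _ _ (`|u x|%:E + `|v x|%:E)%E).
  by rewrite -EFinD lee_fin ler_normD.
by apply: leeD; apply: ereal_sup_ubound; exists x.
Qed.

Lemma supnN u : supn (- u) = supn u.
Proof. by rewrite /supn; under eq_fun do rewrite fctE normrN. Qed.

Lemma norm11E u :
  norm11 u = (supn u + supn u^`() + (sqint u + sqint u^`()) `^ 2^-1)%E.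
Proof. by []. Qed.

Lemma norm11_ge0 u : (0 <= norm11 u)%E.
Proof. by rewrite norm11E !adde_ge0 ?supn_ge0 ?poweR_ge0. Qed.

Lemma norm11_fin_num u : C1H1 u -> norm11 u \is a fin_num.
Proof.
move=> Wu; have [M uM] := C1H1_bounded Wu; case: Wu => _ _ [K uK] iu iu'.
rewrite norm11E !fin_numD (supn_fin uM) (supn_fin uK).
by rewrite -(fineK (sqint_fin iu)) -(fineK (sqint_fin iu')) -EFinD.
Qed.

Lemma sqint_Lnorm f : sqint f = (Lnorm mu 2%:E (EFin \o f) `^ 2)%E.
Proof.
rewrite poweR_Lnorm //; apply: eq_integral => x _ /=.
by rewrite powR_mulrn // real_normK ?num_real.
Qed.

Lemma sqint_norm f : (sqint f < +oo)%E ->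
  exists n : R, [/\ 0 <= n, Lnorm mu 2%:E (EFin \o f) = n%:E & sqint f = (n ^+ 2)%:E].
Proof.
move=> foo.
have : Lnorm mu 2%:E (EFin \o f) \is a fin_num.
  rewrite ge0_fin_numE ?Lnorm_ge0 // ltey; apply/eqP => Ny.
  by move: foo; rewrite sqint_Lnorm Ny poweRyr ?ltxx.
move=> /fineK Nn; exists (fine (Lnorm mu 2%:E (EFin \o f))).
have n0 : 0 <= fine (Lnorm mu 2%:E (EFin \o f)) by rewrite fine_ge0 ?Lnorm_ge0.
by rewrite Nn; split=> //; rewrite sqint_Lnorm -Nn poweR_EFin powR_mulrn.
Qed.

Lemma sqrt_minkowski2 (a b c d : R) : 0 <= a -> 0 <= b -> 0 <= c -> 0 <= d ->
  Num.sqrt ((a + b) ^+ 2 + (c + d) ^+ 2) <=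
  Num.sqrt (a ^+ 2 + c ^+ 2) + Num.sqrt (b ^+ 2 + d ^+ 2).
Proof.
move=> a0 b0 c0 d0.
set s := Num.sqrt (a ^+ 2 + c ^+ 2); set t := Num.sqrt (b ^+ 2 + d ^+ 2).
have s0 : 0 <= s by exact: sqrtr_ge0.
have t0 : 0 <= t by exact: sqrtr_ge0.
have s2 : s ^+ 2 = a ^+ 2 + c ^+ 2 by rewrite sqr_sqrtr // addr_ge0 ?sqr_ge0.
have t2 : t ^+ 2 = b ^+ 2 + d ^+ 2 by rewrite sqr_sqrtr // addr_ge0 ?sqr_ge0.
rewrite -(ger0_norm (addr_ge0 s0 t0)) -sqrtr_sqr ler_sqrt ?sqr_ge0 //.
rewrite [in leRHS]sqrrD s2 t2.
have st : a * b + c * d <= s * t.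
  rewrite -(@ler_pXn2r _ 2) ?nnegrE ?addr_ge0 ?mulr_ge0 //.
  rewrite [in leRHS]exprMn s2 t2 -subr_ge0.
  rewrite [X in 0 <= X](_ : _ = (a * d - b * c) ^+ 2); last by ring.
  exact: sqr_ge0.
rewrite -mulr_natl; lra.
Qed.

Lemma norm11D u v : C1H1 u -> C1H1 v -> (norm11 (u + v)%R <= norm11 u + norm11 v)%E.
Proof.
move=> Wu Wv; have [_ _ _ iw iw'] := C1H1D Wu Wv.
case: Wu => du cu _ iu iu'; case: Wv => dv cv _ iv iv'.
have dE : (u + v)^`() = u^`() + v^`() by apply/funext => x; rewrite derive1D_.
move: iw iw'; rewrite !norm11E dE => iw iw'.
rewrite [leRHS]addeACA leeD //.
  rewrite [leRHS]addeACA; apply: leeD; exact: supnD.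
have cu0 := derivable_cont du; have cv0 := derivable_cont dv.
have := @minkowski_EFin _ _ R mu u v 2 (cont_meas cu0) (cont_meas cv0).
have := @minkowski_EFin _ _ R mu _ _ 2 (cont_meas cu) (cont_meas cv).
have [a [a0 -> ->]] := sqint_norm iu; have [b [b0 -> ->]] := sqint_norm iv.
have [c [c0 -> ->]] := sqint_norm iu'; have [d [d0 -> ->]] := sqint_norm iv'.
have [p [p0 pE ->]] := sqint_norm iw; have [q [q0 qE ->]] := sqint_norm iw'.
have two : (1 <= 2 :> R) by rewrite ler1n.
move=> /(_ two); rewrite [X in (X <= _)%E]qE -EFinD lee_fin => qcd.
move=> /(_ two); rewrite [X in (X <= _)%E]pE -EFinD lee_fin => pab.
rewrite -!EFinD !poweR_EFin -?EFinD lee_fin.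
rewrite !powR12_sqrt ?addr_ge0 ?sqr_ge0 //.
apply: le_trans (sqrt_minkowski2 a0 b0 c0 d0).
by rewrite ler_wsqrtr // lerD // lerXn2r ?nnegrE ?addr_ge0.
Qed.

Lemma norm11N u : C1H1 u -> norm11 (- u) = norm11 u.
Proof.
case=> du _ _ _ _.
have dE : (- u)^`() = - u^`() by apply/funext => x; rewrite derive1N_.
rewrite !norm11E dE !supnN; congr (_ + (_ + _) `^ _)%E.
- by rewrite /sqint; under eq_integral do rewrite fctE sqrrN.
- by rewrite /sqint; under eq_integral do rewrite fctE sqrrN.
Qed.

Lemma norm110 : norm11 (fun=> 0 : R) = 0%E.
Proof.
have d0 : (fun=> 0 : R)^`() = (fun=> 0 : R).
  by apply/funext => x; rewrite derive1_cst.
rewrite norm11E d0.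
have -> : sqint (fun=> 0) = 0%E.
  by rewrite /sqint; under eq_integral do rewrite expr0n /=; rewrite integral0.
have -> : supn (fun=> 0) = 0%E.
  by apply/eqP; rewrite eq_le supn_ge0 andbT; apply: ge_ereal_sup => _ [x _ <-];
    rewrite normr0.
by rewrite !adde0 add0e poweR0r // invr_eq0.
Qed.

Lemma norm11_eq0 u : norm11 u = 0%E -> forall x, u x = 0.
Proof.
move=> u0 x; apply/normr0_eq0/eqP; rewrite eq_le normr_ge0 andbT.
suff : (`|u x|%:E <= norm11 u)%E by rewrite u0 lee_fin.
rewrite norm11E -addeA.
apply: (@le_trans _ _ (supn u)); first by apply: ereal_sup_ubound; exists x.
by rewrite leeDl // adde_ge0 ?supn_ge0 ?poweR_ge0.
Qed.

Lemma derive1_subid (eta : R -> R) : (forall x, derivable eta x 1) ->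
  (eta - id)^`() = eta^`() - cst 1.
Proof.
move=> deta; apply/funext => x; rewrite derive1E deriveB //.
by rewrite derive_id !fctE derive1E.
Qed.

Lemma inD_C1H1 eta : inD eta -> C1H1 (eta - id).
Proof.
move=> [[deta ceta] [a [b [a0 [ab etaab]]]] [i1 i2] _].
split; rewrite ?(derive1_subid deta) //.
- by move=> x; apply: derivableB.
- by move=> x; apply: cvgB; [exact: ceta|exact: cvg_cst].
- exists (b + 1) => x; rewrite !fctE.
  have /andP[? ?] := etaab x; rewrite ler_norml; lra.
- by rewrite /sqint; under eq_integral do rewrite -(real_normK (num_real _)).
- by rewrite /sqint; under eq_integral do rewrite -(real_normK (num_real _)).
Qed.

Lemma inD_C1H1B eta xi : inD eta -> inD xi -> C1H1 (eta - xi).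
Proof.
move=> /inD_C1H1 Weta /inD_C1H1 Wxi.
rewrite (_ : eta - xi = (eta - id) + - (xi - id)); first exact: C1H1D (C1H1N _).
by apply/funext => x; rewrite !fctE; ring.
Qed.

Lemma inD_infty eta : inD eta ->
  eta x @[x --> -oo] --> -oo /\ eta x @[x --> +oo] --> +oo.
Proof.
move=> [[deta _] [a [b [a0 [ab etaab]]]] _ _].
have slope x y : x < y -> a * (y - x) <= eta y - eta x.
  move=> xy; have [c ->] := mvt deta xy.
  by rewrite ler_pM2r ?subr_gt0 //; have /andP[] := etaab c.
split.
- apply/cvgrNyPle => A; near=> x.
  have x0 : x < 0 by near: x; exact: nbhs_ninfty_lt.
  have xA : x <= (A - eta 0) / a by near: x; apply: nbhs_ninfty_le; exact: num_real.
  have := slope _ _ x0; move: xA; rewrite ler_pdivlMr //; lra.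
- apply/cvgryPge => A; near=> x.
  have x0 : 0 < x by near: x; exact: nbhs_pinfty_gt.
  have xA : (A - eta 0) / a <= x by near: x; apply: nbhs_pinfty_ge; exact: num_real.
  have := slope _ _ x0; move: xA; rewrite ler_pdivrMr //; lra.
Unshelve. all: by end_near. Qed.

Lemma sqint_comp eta f : inD eta -> continuous f ->
  (sqint f < +oo)%E -> (sqint (f \o eta) < +oo)%E.
Proof.
move=> Deta cf foo; have [etaNy etay] := inD_infty Deta.
case: Deta => -[deta ceta] [a [b [a0 [ab etaab]]]] _ [limNy limy].
have ceta0 := derivable_cont deta.
have cfe : continuous (f \o eta).
  by move=> x; apply: continuous_comp; [exact: ceta0|exact: cf].
have cf2 : continuous (fun x => f x ^+ 2).
  by move=> x; apply: continuousM; exact: cf.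
have cfe2 : continuous ((fun x => f x ^+ 2) \o eta).
  by move=> x; apply: continuous_comp; [exact: ceta0|exact: cf2].
have homo_eta : {homo eta : x y / x < y}.
  move=> x y xy; have [c e] := mvt deta xy.
  rewrite -subr_gt0 e mulr_gt0 ?subr_gt0 //.
  by have /andP[+ _] := etaab c; exact: lt_le_trans.
have subst := @increasing_ge0_integration_by_substitutionT R eta
  (fun x => f x ^+ 2) homo_eta ceta (cvgP _ limNy) (cvgP _ limy) deta etaNy etay
  cf2 (fun x => sqr_ge0 _).
move: foo; rewrite /sqint subst => foo.
apply: (@le_lt_trans _ _
  (a^-1%:E * \int[mu]_x ((((fun x => f x ^+ 2) \o eta) * eta^`()) x)%:E)%E);
  last by rewrite lte_mul_pinfty // ?lee_fin ?invr_ge0 ?ltW.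
have meas : measurable_fun setT (fun x =>
    ((((fun x => f x ^+ 2) \o eta) * eta^`()) x)%:E : \bar R).
  apply/measurable_EFinP/measurable_funM; last exact: cont_meas.
  exact: (cont_meas cfe2).
have ai0 : 0 <= a^-1 by rewrite invr_ge0 ltW.
have nneg x : 0 <= (((fun x => f x ^+ 2) \o eta) * eta^`()) x.
  rewrite mulr_ge0 ?sqr_ge0 //.
  by have /andP[+ _] := etaab x; apply: le_trans; exact: ltW.
rewrite -ge0_integralZl_EFin //; last by move=> x _; rewrite lee_fin nneg.
apply: ge0_le_integral => //.
- by move=> x _; rewrite lee_fin sqr_ge0.
- exact: meas_sq.
- exact: measurable_funeM.
- move=> x _; rewrite -EFinM lee_fin !fctE /=.
  rewrite mulrCA ler_peMr ?sqr_ge0 // mulrC ler_pdivlMr // mul1r.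
  by have /andP[] := etaab x.
Qed.

Lemma inD_comp xi eta : inD xi -> inD eta -> inD (xi \o eta).
Proof.
move=> Dxi Deta.
have Wxi := inD_C1H1 Dxi; have Weta := inD_C1H1 Deta.
have [etaNy etay] := inD_infty Deta.
have cmp f := @sqint_comp eta f Deta.
case: Dxi => -[dxi cxi] [a [b [a0 [ab xiab]]]] _ [xiNy xiy].
case: Deta => -[deta ceta] [c [d [c0 [cd etacd]]]] _ [limNy limy].
have cxi0 := derivable_cont dxi; have ceta0 := derivable_cont deta.
have dE : (xi \o eta)^`() = (fun x => xi^`() (eta x) * eta^`() x).
  by apply/funext => x; rewrite derive1_comp.
have cc : continuous (xi^`() \o eta).
  by move=> x; apply: continuous_comp; [exact: ceta0|exact: cxi].
have ccd : continuous (fun x => xi^`() (eta x) * eta^`() x).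
  by move=> x; exact: (continuousM (cc x) (ceta x)).
have sq (x y : R) : (x + y) ^+ 2 <= 2 * x ^+ 2 + 2 * y ^+ 2.
  rewrite -subr_ge0 [X in 0 <= X](_ : _ = (x - y) ^+ 2); last by ring.
  exact: sqr_ge0.
have [dux cux _ iux iux'] := Wxi; have [due cue _ iue iue'] := Weta.
rewrite (derive1_subid dxi) in cux iux'; rewrite (derive1_subid deta) in cue iue'.
have cux0 := derivable_cont dux; have cue0 := derivable_cont due.
have d0 : 0 < d by lra.
have two0 : 0 <= 2 :> R by exact: ler0n.
have dxe x : derivable (xi \o eta) x 1.
  apply/derivable1_diffP; apply: differentiable_comp; apply/derivable1_diffP.
    exact: deta.
  exact: dxi.
have norm2 (g : R -> R) : (\int[mu]_x (`|g x| ^+ 2)%:E)%E = sqint g.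
  by rewrite /sqint; under eq_integral do rewrite real_normK ?num_real //.
split; rewrite ?dE.
- by split; [exact: dxe|exact: ccd].
- exists (a * c), (b * d); split; first exact: mulr_gt0.
  split; first by rewrite ltr_pM // ltW.
  move=> x; have /andP[? ?] := xiab (eta x); have /andP[? ?] := etacd x.
  apply/andP; split; apply: ler_pM => //; [lra|lra| |].
    by apply: le_trans (ltW a0) _.
  by apply: le_trans (ltW c0) _.
- split.
    rewrite (norm2 (fun x => xi (eta x) - x)).
    have cl : continuous ((xi - id) \o eta).
      by move=> x; apply: continuous_comp; [exact: ceta0|exact: cux0].
    have cr : continuous (fun x => xi (eta x) - x).
      move=> x; apply: cvgB; last exact: cvg_id.
      by apply: continuous_comp; [exact: ceta0|exact: cxi0].
    apply: (sqint_lin_fin cl cue0 cr two0 _ (cmp _ cux0 iux) iue) => x.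
    apply: le_trans (sq _ _); rewrite !fctE /= addrA subrK.
    exact: lexx.
  rewrite (norm2 (fun x => xi^`() (eta x) * eta^`() x - 1)).
  have cl : continuous ((xi^`() - cst 1) \o eta).
    by move=> x; apply: continuous_comp; [exact: ceta0|exact: cux].
  have cr : continuous (fun x => xi^`() (eta x) * eta^`() x - 1).
    by move=> x; apply: cvgB; [exact: ccd|exact: cvg_cst].
  have c2 : 0 <= 2 * d ^+ 2 + 2 by have := sqr_ge0 d; lra.
  apply: (sqint_lin_fin cl cue cr c2 _ (cmp _ cux iux') iue') => x.
  rewrite !fctE /=.
  have : c <= eta^`() x <= d by exact: etacd.
  move: (xi^`() _) (eta^`() x) => p q /andP[cq qd].
  have -> : p * q - 1 = (p - 1) * q + (q - 1) by ring.
  apply: le_trans (sq _ _) _; rewrite exprMn.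
  have {}qd : q ^+ 2 <= d ^+ 2 by rewrite lerXn2r ?nnegrE //; lra.
  have := ler_wpM2l (sqr_ge0 (p - 1)) qd.
  have := mulr_ge0 (sqr_ge0 d) (sqr_ge0 (q - 1)).
  have := sqr_ge0 (p - 1).
  move: ((p - 1) ^+ 2) ((q - 1) ^+ 2) (d ^+ 2) (q ^+ 2) => P Q D Z ? ? ?.
  lra.
- have xeNy : xi^`() (eta x) @[x --> -oo] --> (1 : R).
    by apply: cvg_comp; [exact: etaNy|exact: xiNy].
  have xey : xi^`() (eta x) @[x --> +oo] --> (1 : R).
    by apply: cvg_comp; [exact: etay|exact: xiy].
  split; [have := cvgM xeNy limNy|have := cvgM xey limy]; rewrite mulr1; apply.
Qed.

End helpers.

Record Dgroup (R : realType) := MkD { Dfun :> R -> R ; DfunP : inD Dfun }.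

Section topology.
Context {R : realType}.

HB.instance Definition _ := gen_eqMixin (Dgroup R).
HB.instance Definition _ := gen_choiceMixin (Dgroup R).

Definition Ddist (eta xi : Dgroup R) : R := fine (norm11 (eta \- xi)).

Lemma Ddist_fin_num (eta xi : Dgroup R) : norm11 (eta \- xi) \is a fin_num.
Proof. exact: norm11_fin_num (inD_C1H1B (DfunP eta) (DfunP xi)). Qed.

Lemma Ddist_EFin eta xi : (Ddist eta xi)%:E = norm11 (eta \- xi).
Proof. by rewrite /Ddist fineK // Ddist_fin_num. Qed.

Lemma Ddistxx eta : Ddist eta eta = 0.
Proof.
rewrite /Ddist (_ : _ \- _ = fun=> 0) ?norm110 //.
by apply/funext => x /=; rewrite subrr.
Qed.

Lemma Ddist_eq0 eta xi : Ddist eta xi = 0 -> eta = xi.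
Proof.
move=> d0; have /norm11_eq0 e : norm11 (eta \- xi) = 0%E by rewrite -Ddist_EFin d0.
have {e d0} : Dfun eta = Dfun xi by apply/funext => x; apply/subr0_eq/e.
case: eta xi => [f fP] [g gP] /= fg; move: fP gP; rewrite fg => fP gP.
by rewrite (Prop_irrelevance fP gP).
Qed.

Lemma Ddist_sym eta xi : Ddist eta xi = Ddist xi eta.
Proof.
rewrite /Ddist -(norm11N (inD_C1H1B (DfunP eta) (DfunP xi))); congr (fine (norm11 _)).
by apply/funext => x; rewrite !fctE /= opprB.
Qed.

Lemma Ddist_triangle xi eta zeta :
  Ddist eta zeta <= Ddist eta xi + Ddist xi zeta.
Proof.
have e : eta \- zeta = (Dfun eta - Dfun xi) + (Dfun xi - Dfun zeta).
  by apply/funext => x; rewrite !fctE /= addrA subrK.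
have := norm11D (inD_C1H1B (DfunP eta) (DfunP xi)) (inD_C1H1B (DfunP xi) (DfunP zeta)).
have := congr1 norm11 e; rewrite -Ddist_EFin => <-.
rewrite -[X in (_ <= X + _)%E]/(norm11 (eta \- xi)).
rewrite -[X in (_ <= _ + X)%E]/(norm11 (xi \- zeta)).
by rewrite -(Ddist_EFin eta xi) -(Ddist_EFin xi zeta) -EFinD lee_fin.
Qed.

HB.instance Definition _ := @isMetric.Build R (Dgroup R) Ddist
  Ddistxx Ddist_eq0 Ddist_sym Ddist_triangle.

Definition Dcomp (p : Dgroup R * Dgroup R) : Dgroup R :=
  MkD (inD_comp (DfunP p.1) (DfunP p.2)).

End topology.

(* Main.v *)
Require Import Defs.
From mathcomp Require Import all_boot all_order all_algebra.
From mathcomp Require Import ring lra.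
From mathcomp Require Import all_classical all_reals all_analysis measurable_realfun.
Set Implicit Arguments.
Unset Strict Implicit.
Unset Printing Implicit Defensive.
Import Order.TTheory GRing.Theory Num.Theory.
Import numFieldNormedType.Exports.

Local Open Scope classical_set_scope.
Local Open Scope ring_scope.

Local Notation "f ^` ()" := (derive1 f) : ring_scope.

(** Write [w = xi - xi0] and [v = eta - eta0].  The two identities

      xi o eta - xi0 o eta0 = w o eta + (xi0 o eta - xi0 o eta0),

      (xi o eta - xi0 o eta0)' = (w' o eta) eta'
          + (xi0' o eta - xi0' o eta0) eta' + (xi0' o eta0) v'

    reduce the theorem to estimates in the sup norm and in L^2 at once, and
    [LinfL2_le r f] (both norms of [f] are at most [r]) carries all of them.
    The terms with [w] or [w'] are controlled by the change of variables
    [y = eta x], whose Jacobian stays above [a / 2] near [eta0] if [eta0' >= a]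
    ([LinfL2_le_comp]).  The second term of the first identity is at most a
    multiple of [v] since [xi0] is Lipschitz, and the terms with [v'] are
    products with a bounded function ([LinfL2_le_dom]).

    The term [xi0' o eta - xi0' o eta0] is not bounded by a multiple of [v],
    because [xi0'] is merely continuous.  It equals [g o eta - g o eta0] with [g = xi0' - 1], a continuous
    function in L^2 that tends to 0 at infinity ([comp_close_of_vanishing]).
    Split [g] as [p + q] with [p] its truncation to [-t, t].  For [t] small [p]
    is small in both norms by dominated convergence
    ([exists_clamp_LinfL2_le]), hence so are [p o eta] and [p o eta0] by the
    change of variables.  As [g] vanishes at infinity, [q] has compact support,
    so [q o eta - q o eta0] lives on one fixed segment, where uniform continuity
    makes it small ([comp_close_of_compact_support]). *)

Section composition.
Context {R : realType}.
Notation mu := (@lebesgue_measure R).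
Implicit Types (f g h q u v eta xi : R -> R) (r s t : R).

(** * Bounds in the sup and L^2 norms *)

(** One bound for both norms: it is additive, monotone and stable under
    [inD] changes of variables, and the norm of D(R) amounts to this bound for
    a function and for its derivative. *)
Definition LinfL2_le r f : Prop :=
  (forall x, `|f x| <= r) /\ (sqint f <= (r ^+ 2)%:E)%E.

Lemma LinfL2_le_ge0 r f : LinfL2_le r f -> 0 <= r.
Proof. by move=> [/(_ 0) + _]; exact: le_trans. Qed.

Lemma LinfL2_le_sqint_fin r f : LinfL2_le r f -> (sqint f < +oo)%E.
Proof. by move=> [_ /le_lt_trans]; apply; exact: ltry. Qed.

Lemma LinfL2_leW r s f : r <= s -> LinfL2_le r f -> LinfL2_le s f.
Proof.
move=> rs fr; have r0 := LinfL2_le_ge0 fr; case: fr => fr f2r.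
split=> [x|]; first exact: le_trans (fr x) rs.
by rewrite (le_trans f2r) // lee_fin lerXn2r ?nnegrE // (le_trans r0).
Qed.

(** Minkowski's inequality is what keeps the constant of the L^2 part equal to
    [r + s], the one of the sup part. *)
Lemma LinfL2_le_add r s f g : continuous f -> continuous g ->
  LinfL2_le r f -> LinfL2_le s g -> LinfL2_le (r + s) (f \+ g).
Proof.
move=> cf cg fr gs.
have r0 := LinfL2_le_ge0 fr; have s0 := LinfL2_le_ge0 gs.
have ioof := LinfL2_le_sqint_fin fr; have ioog := LinfL2_le_sqint_fin gs.
case: fr gs => [fr f2r] [gs g2s].
split=> [x|].
  by rewrite (le_trans (ler_normD _ _)) // lerD.
have ioofg : (sqint (f \+ g)%R < +oo)%E.
  apply: (@sqint_lin_fin _ 2 f g) => //.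
    by move=> x; apply: cvgD; [exact: cf|exact: cg].
  move=> x /=; rewrite -subr_ge0 [leRHS](_ : _ = (f x - g x) ^+ 2); last by ring.
  exact: sqr_ge0.
have := @minkowski_EFin _ _ R mu f g 2 (cont_meas cf) (cont_meas cg).
have [a [a0 aE aE2]] := sqint_norm ioof; have [b [b0 bE bE2]] := sqint_norm ioog.
have [c [c0 cE cE2]] := sqint_norm ioofg.
move=> /(_ (ler1n _ _)); rewrite aE bE cE -EFinD lee_fin => cab.
move: f2r g2s; rewrite aE2 bE2 cE2 !lee_fin.
rewrite !ler_pXn2r ?nnegrE ?addr_ge0 // => ar bs.
by rewrite (le_trans cab) // lerD.
Qed.

Lemma LinfL2_le_dom (k r : R) f g : continuous f -> continuous g -> 0 <= k ->
  (forall x, `|g x| <= k * `|f x|) -> LinfL2_le r f -> LinfL2_le (k * r) g.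
Proof.
move=> cf cg k0 gkf [fr f2r]; split=> [x|].
  by rewrite (le_trans (gkf x)) // ler_wpM2l.
apply: (@le_trans _ _ ((k ^+ 2)%:E * sqint f)%E); last first.
  by rewrite exprMn [leRHS]EFinM; apply: lee_wpmul2l; rewrite ?lee_fin ?sqr_ge0.
rewrite /sqint -ge0_integralZl_EFin //; last 3 first.
- by move=> x _; rewrite lee_fin sqr_ge0.
- exact: meas_sq.
- exact: sqr_ge0.
apply: ge0_le_integral => //.
- by move=> x _; rewrite lee_fin sqr_ge0.
- exact: meas_sq.
- by apply: measurable_funeM; exact: meas_sq.
- move=> x _; rewrite -EFinM lee_fin -(real_normK (num_real (g x))).
  rewrite -(real_normK (num_real (f x))) -exprMn lerXn2r ?nnegrE //.
  by rewrite mulr_ge0.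
Qed.

(** Substituting [y = eta x] gives
    [\int f ^ 2 = \int (f o eta) ^ 2 * eta'], and [eta' >= m].  The constant
    depends on [eta] through [m] only, hence is uniform near a given point of
    D(R). *)
Lemma sqint_comp_le eta f (m : R) : inD eta -> 0 < m ->
  (forall x, m <= eta^`() x) -> continuous f ->
  (sqint (f \o eta) <= m^-1%:E * sqint f)%E.
Proof.
move=> Deta m0 meta cf; have [etaNy etay] := inD_infty Deta.
case: Deta => -[deta ceta] _ _ [limNy limy].
have ceta0 := derivable_cont deta.
have cfe : continuous (f \o eta).
  by move=> x; apply: continuous_comp; [exact: ceta0|exact: cf].
have cf2 : continuous (fun x => f x ^+ 2).
  by move=> x; apply: continuousM; exact: cf.
have cfe2 : continuous ((fun x => f x ^+ 2) \o eta).
  by move=> x; apply: continuous_comp; [exact: ceta0|exact: cf2].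
have homo_eta : {homo eta : x y / x < y}.
  move=> x y xy; have [c e] := mvt deta xy.
  by rewrite -subr_gt0 e mulr_gt0 ?subr_gt0 // (lt_le_trans m0).
rewrite [in leRHS]/sqint (@increasing_ge0_integration_by_substitutionT R eta
  (fun x => f x ^+ 2) homo_eta ceta (cvgP _ limNy) (cvgP _ limy) deta etaNy etay
  cf2 (fun x => sqr_ge0 _)).
have meas : measurable_fun setT (fun x =>
    ((((fun x => f x ^+ 2) \o eta) * eta^`()) x)%:E : \bar R).
  apply/measurable_EFinP/measurable_funM; last exact: cont_meas.
  exact: (cont_meas cfe2).
have mi0 : 0 <= m^-1 by rewrite invr_ge0 ltW.
rewrite -ge0_integralZl_EFin //; last first.
  move=> x _; rewrite lee_fin mulr_ge0 ?sqr_ge0 //.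
  by rewrite (le_trans (ltW m0)).
apply: ge0_le_integral => //.
- by move=> x _; rewrite lee_fin sqr_ge0.
- exact: meas_sq.
- exact: measurable_funeM.
- move=> x _; rewrite -EFinM lee_fin !fctE /=.
  by rewrite mulrCA ler_peMr ?sqr_ge0 // mulrC ler_pdivlMr // mul1r.
Qed.

(** Composition costs a factor [1] in the sup norm and [m ^ (-1/2)] in L^2; the
    two hypotheses on [k] say that it dominates both, without square roots. *)
Lemma LinfL2_le_comp eta f (k m r : R) : inD eta -> 0 < m ->
  (forall x, m <= eta^`() x) -> 1 <= k -> 1 <= k ^+ 2 * m -> continuous f ->
  LinfL2_le r f -> LinfL2_le (k * r) (f \o eta).
Proof.
move=> Deta m0 meta k1 k2m cf fr; have r0 := LinfL2_le_ge0 fr.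
case: fr => fr f2r; split=> [x|].
  by rewrite (le_trans (fr _)) // ler_peMl.
rewrite (le_trans (sqint_comp_le Deta m0 meta cf)) // exprMn [leRHS]EFinM.
apply: lee_pmul => //; rewrite ?lee_fin ?invr_ge0 ?sqint_ge0 ?(ltW m0) //.
by rewrite -[m^-1]mul1r ler_pdivrMr.
Qed.

(** * Comparison with the norm of D(R) *)

Lemma LinfL2_le_norm11 r u : LinfL2_le r u -> LinfL2_le r u^`() ->
  (norm11 u <= (4 * r)%:E)%E.
Proof.
move=> ur u'r; have r0 := LinfL2_le_ge0 ur.
have := LinfL2_le_sqint_fin ur; have := LinfL2_le_sqint_fin u'r.
move: ur u'r => [ur u2r] [u'r u'2r].
move=> /sqint_norm[a [a0 _ aE]] /sqint_norm[b [b0 _ bE]].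
move: u2r u'2r; rewrite aE bE !lee_fin => br ar.
rewrite norm11E aE bE -EFinD poweR_EFin powR12_sqrt ?addr_ge0 ?sqr_ge0 //.
rewrite [4 * r](_ : _ = r + r + 2 * r); last by ring.
rewrite !EFinD; apply: leeD; first apply: leeD.
- by apply: ge_ereal_sup => _ [x _ <-]; rewrite lee_fin.
- by apply: ge_ereal_sup => _ [x _ <-]; rewrite lee_fin.
have r20 : 0 <= 2 * r by lra.
rewrite lee_fin -(ger0_norm r20) -sqrtr_sqr ler_sqrt ?sqr_ge0 // exprMn.
have := sqr_ge0 r; lra.
Qed.

Lemma norm11_LinfL2_le r u :
  (norm11 u <= r%:E)%E -> LinfL2_le r u /\ LinfL2_le r u^`().
Proof.
rewrite norm11E => ur.
have pw0 : (0 <= (sqint u + sqint u^`()) `^ 2^-1)%E by exact: poweR_ge0.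
have r0 : 0 <= r.
  by rewrite -lee_fin (le_trans _ ur) // !adde_ge0 // supn_ge0.
have supu : (supn u <= r%:E)%E.
  by rewrite (le_trans _ ur) // -addeA leeDl // adde_ge0 // supn_ge0.
have supu' : (supn u^`() <= r%:E)%E.
  by rewrite (le_trans _ ur) // addeAC leeDr // adde_ge0 // supn_ge0.
have pwr : ((sqint u + sqint u^`()) `^ 2^-1 <= r%:E)%E.
  by rewrite (le_trans _ ur) // leeDr // adde_ge0 // supn_ge0.
have sqr : (sqint u + sqint u^`() <= (r ^+ 2)%:E)%E.
  move: pwr; move: (adde_ge0 (sqint_ge0 u) (sqint_ge0 u^`())).
  case: (_ + _)%E => [x| |] // x0.
    rewrite poweR_EFin !lee_fin powR12_sqrt; last by rewrite -lee_fin.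
    move=> xr; rewrite -(@sqr_sqrtr _ x); last by rewrite -lee_fin.
    by rewrite lerXn2r ?nnegrE ?sqrtr_ge0.
  by rewrite poweRyr ?invr_eq0 ?pnatr_eq0 // leye_eq.
have sup_le v x : (supn v <= r%:E)%E -> `|v x| <= r.
  by move=> vr; rewrite -lee_fin (le_trans _ vr) //; apply: ereal_sup_ubound; exists x.
split; split=> [x|]; try exact: sup_le.
- by rewrite (le_trans _ sqr) // leeDl // sqint_ge0.
- by rewrite (le_trans _ sqr) // leeDr // sqint_ge0.
Qed.

(** * Truncation *)

(** Truncation is used for its complement: [y - clamp t y] vanishes where [|y| <= t],
    so subtracting the truncation from a function that tends to 0 at infinity
    leaves a function of compact support. *)
Definition clamp t (y : R) : R := Num.max (- t) (Num.min t y).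

Lemma norm_clamp_le t y : 0 <= t -> `|clamp t y| <= t.
Proof.
move=> t0; rewrite ler_norml /clamp le_max lexx /= ge_max ge_min lexx /= andbT.
by rewrite (le_trans _ t0) // oppr_le0.
Qed.

Lemma norm_clamp_le_norm t y : 0 <= t -> `|clamp t y| <= `|y|.
Proof.
move=> t0; rewrite /clamp; have := ler_norm y; have := ler_norm (- y).
rewrite normrN.
case: (leP t y) => ty; [case: (leP (- t) t)|case: (leP (- t) y)] => ? ? ?.
all: rewrite ler_norml; lra.
Qed.

Lemma clamp_id t y : `|y| <= t -> clamp t y = y.
Proof.
by rewrite /clamp ler_norml => /andP[ty yt]; rewrite (min_r yt) (max_r ty).
Qed.

Lemma continuous_clamp t g : continuous g -> continuous (fun x => clamp t (g x)).
Proof.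
move=> cg x.
apply: (@continuous_max R R (cst (- t)) (cst t \min g)); first exact: cvg_cst.
by apply: continuous_min; [exact: cvg_cst|exact: cg].
Qed.

(** Dominated convergence: [clamp t (g x)] tends to 0 with [t], and its square
    is below [g x ^ 2]. *)
Lemma exists_clamp_LinfL2_le g : continuous g -> (sqint g < +oo)%E ->
  forall r : R, 0 < r ->
  exists2 t, 0 < t & LinfL2_le r (fun x => clamp t (g x)).
Proof.
move=> cg goo r r0.
pose tn n : R := n.+1%:R^-1.
have tn0 n : 0 < tn n by rewrite invr_gt0 ltr0n.
have tn_cvg : tn n @[n --> \oo] --> (0 : R) by exact: cvg_harmonic.
pose fn n x : \bar R := (clamp (tn n) (g x) ^+ 2)%:E.
have [|||||_ _] := @dominated_convergence _ _ R mu setT measurableT fn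
    (cst 0%E) (fun x => (g x ^+ 2)%:E).
- by move=> n; apply: meas_sq; exact: continuous_clamp.
- exact: measurable_cst.
- apply: aeW => x _; apply: cvg_EFin; first by near=> n.
  apply/cvgr0Pnorm_le => e e0; near=> n.
  have tne : tn n <= Num.min 1 e.
    by near: n; apply: (cvgr_le _ tn_cvg); rewrite lt_min ltr01.
  have := norm_clamp_le (g x) (ltW (tn0 n)).
  move: tne; rewrite le_min => /andP[tn1 tne] gn.
  rewrite /= normrX expr2 -[e]mul1r ler_pM // (le_trans gn) //.
- apply/integrableP; split; first exact: meas_sq.
  rewrite (le_lt_trans _ goo) // /sqint; under eq_integral do
    rewrite abse_EFin ger0_norm ?sqr_ge0 //.
  exact: lexx.
- apply: aeW => x n _; rewrite /fn abse_EFin lee_fin normrX.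
  rewrite -[leRHS](real_normK (num_real _)) lerXn2r ?nnegrE //.
  by rewrite norm_clamp_le_norm // ltW.
rewrite integral0 => /fine_cvgP[fin /cvgr0Pnorm_le/(_ _ (exprn_gt0 2 r0)) small].
near \oo%classic => n.
exists (tn n) => //.
have tnr : tn n <= r by near: n; apply: (cvgr_le _ tn_cvg).
split=> [x|].
  by rewrite (le_trans _ tnr) // norm_clamp_le // ltW.
have : `|fine (sqint (fun x => clamp (tn n) (g x)))| <= r ^+ 2 by near: n.
have nfin : sqint (fun x => clamp (tn n) (g x)) \is a fin_num by near: n.
rewrite ger0_norm ?fine_ge0 ?sqint_ge0 // => le_r2.
by rewrite -(fineK nfin) lee_fin.
Unshelve. all: by end_near. Qed.

(** * Continuity of the composition with a fixed function on the left *)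

(** Heine's argument on the graph of [h]: only the base point of the comparison
    runs over a compact set, [z] need not be in the image of [h]. *)
Lemma unif_near_on_segment q h (L : R) : continuous q -> continuous h ->
  forall w : R, 0 < w -> exists2 d, 0 < d &
    forall x z : R, - L <= x <= L -> `|z - h x| <= d -> `|q z - q (h x)| <= w.
Proof.
move=> cq ch w w0.
have /compact_near_coveringP cpt := @segment_compact R (- L) L.
pose P (d x : R) := forall z : R, `|z - h x| <= d -> `|q z - q (h x)| <= w.
have [|] := cpt R (at_right (0 : R)) P (at_right_proper_filter (0 : R)).
  move=> x _.
  have w20 : 0 < w / 2 by lra.
  have /cvgrPdist_lt/(_ _ w20)/nbhs_ballP[e /= e0 qe] := cq (h x).
  have e20 : 0 < e / 2 by lra.
  near=> x' d => /= z zd.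
  have hx' : `|h x - h x'| < e / 2.
    by near: x'; have /cvgrPdist_lt/(_ _ e20) := ch x; apply.
  have de : d < e / 2 by near: d; exact: nbhs_right_lt.
  have q1 : `|q (h x) - q (h x')| < w / 2.
    by apply: qe; rewrite /ball /=; lra.
  have q2 : `|q (h x) - q z| < w / 2.
    apply: qe; rewrite /ball /=.
    have := ler_distD (h x') (h x) z; rewrite (distrC (h x') z); lra.
  have := ler_distD (q (h x)) (q z) (q (h x')); rewrite (distrC (q z) (q (h x))).
  lra.
move=> d /= d0 Hd; exists (d / 2); first by lra.
move=> x z xL zd; apply: (Hd (d / 2)) => //=.
- by rewrite sub0r normrN gtr0_norm; lra.
- by lra.
Unshelve. all: by end_near. Qed.

(** On a segment of length [2 L] the sup norm controls the L^2 norm. *)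
Lemma LinfL2_le_support u (L w r : R) : continuous u -> 0 <= L -> 0 <= w ->
  (forall x, - L <= x <= L -> `|u x| <= w) ->
  (forall x, ~~ (- L <= x <= L) -> u x = 0) ->
  w <= r -> w ^+ 2 * (2 * L) <= r ^+ 2 -> LinfL2_le r u.
Proof.
move=> cu L0 w0 uw u0 wr w2r; split=> [x|].
  have [xL|xL] := boolP (- L <= x <= L); first by rewrite (le_trans (uw x xL)).
  by rewrite (u0 x xL) normr0 (le_trans w0).
pose J : set R := [set` `[- L, L]].
have mJ : measurable J by exact: measurable_itv.
have muJ : (mu J <= (2 * L)%:E)%E.
  rewrite /J lebesgue_measure_itv /= lte_fin; case: ifP => _.
    by rewrite -EFinB lee_fin; lra.
  by rewrite lee_fin; lra.
have -> : sqint u = (\int[mu]_(x in J) (u x ^+ 2)%:E)%E.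
  rewrite [RHS]integral_mkcond; apply: eq_integral => x _.
  rewrite /patch; case: ifPn => // xJ; rewrite u0 ?expr0n //.
  by apply: contra xJ => xL; rewrite inE /J /= in_itv.
apply: (@le_trans _ _ (\int[mu]_(y in J) (cst (w ^+ 2)%:E y))%E).
  apply: ge0_le_integral => //.
  - by move=> y _; rewrite lee_fin sqr_ge0.
  - by apply: measurable_funTS; exact: meas_sq.
  - move=> y; rewrite /J /= in_itv /= => yL; rewrite lee_fin.
    by rewrite -(real_normK (num_real (u y))) lerXn2r ?nnegrE ?uw.
rewrite integral_cst // (le_trans (lee_wpmul2l _ muJ)) ?lee_fin ?sqr_ge0 //.
Qed.

(** Preimages of bounded sets under [eta] are bounded since [eta] is proper. *)
Lemma inD_norm_gt eta (M : R) : inD eta ->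
  exists2 L, 0 <= L & forall x, ~~ (- L <= x <= L) -> M < `|eta x|.
Proof.
move=> /inD_infty[/cvgrNyPlt/(_ (- M)) [A [_ HA]] /cvgryPgt/(_ M) [B [_ HB]]].
exists (`|A| + `|B|); first by rewrite addr_ge0.
move=> x; rewrite negb_and -!ltNge => /orP[] xL.
  have : eta x < - M.
    by apply: HA; have := ler_norm (- A); have := normr_ge0 B; rewrite normrN; lra.
  by have := ler_norm (- eta x); rewrite normrN; lra.
have : M < eta x.
  by apply: HB; have := ler_norm B; have := normr_ge0 A; lra.
by have := ler_norm (eta x); lra.
Qed.

(** If [|eta - eta0| <= 1], both compositions vanish where
    [|eta0 x| > M + 1], hence off a segment that does not depend on [eta]. *)
Lemma comp_close_of_compact_support q (eta0 : R -> R) (M : R) :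
  inD eta0 -> continuous q ->
  (forall y, M < `|y| -> q y = 0) ->
  forall r : R, 0 < r -> exists2 d, 0 < d & forall eta, continuous eta ->
    (forall x, `|eta x - eta0 x| <= d) ->
    LinfL2_le r (fun x => q (eta x) - q (eta0 x)).
Proof.
move=> D0 cq qM r r0.
have ceta0 : continuous eta0 by case: D0 => -[d0 _] _ _ _; exact: derivable_cont.
have [L L0 HL] := inD_norm_gt (M + 1) D0.
(* With this [w], both [w <= r] and [w ^ 2 * (2 * L) <= r ^ 2]. *)
pose w := r / (1 + 2 * L).
have den : 0 < 1 + 2 * L by lra.
have w0 : 0 < w by rewrite divr_gt0.
have [d d0 Hd] := unif_near_on_segment L cq ceta0 w0.
exists (Num.min 1 d); first by rewrite lt_min ltr01.
move=> eta ceta etad.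
have ceq (h : R -> R) : continuous h -> continuous (fun x => q (h x)).
  by move=> ch x; apply: continuous_comp; [exact: ch|exact: cq].
apply: (@LinfL2_le_support _ L w) => //; rewrite ?(ltW w0) //.
- by move=> x; apply: cvgB; exact: ceq.
- by move=> x xL; apply: Hd => //; have := etad x; rewrite le_min => /andP[].
- move=> x /HL etaM; have := etad x; rewrite le_min => /andP[eta1 _].
  have := ler_distD (eta x) (eta0 x) 0; rewrite !subr0 distrC => tri.
  by rewrite !qM ?subrr //; lra.
- by rewrite /w ler_pdivrMr // ler_peMr //; lra.
- rewrite /w expr_div_n mulrAC ler_pdivrMr ?exprn_gt0 // ler_wpM2l ?sqr_ge0 //.
  by have := sqr_ge0 L; rewrite sqrrD expr1n exprMn; lra.
Qed.

(** A factor for [LinfL2_le_comp] that depends on the lower bound [m] only. *)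
Lemma exists_comp_factor (m : R) : 0 < m -> exists2 k, 1 <= k & 1 <= k ^+ 2 * m.
Proof.
move=> m0; have mi0 : 0 < m^-1 by rewrite invr_gt0.
(* [k ^ 2 * m = m + 2 + 1 / m]. *)
exists (1 + m^-1); first by rewrite lerDl ltW.
have -> : (1 + m^-1) ^+ 2 * m = m + 2 + m^-1 by field; rewrite gt_eqF.
lra.
Qed.

Lemma inD_continuous eta : inD eta -> continuous eta.
Proof. by move=> [[deta _] _ _ _]; exact: derivable_cont. Qed.

Lemma LinfL2_le_opp r f : continuous f -> LinfL2_le r f -> LinfL2_le r (\- f).
Proof.
move=> cf fr; rewrite -[r]mul1r; apply: (LinfL2_le_dom cf) fr => //.
  by move=> x; apply: cvgN; exact: cf.
by move=> x; rewrite /= normrN mul1r.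
Qed.

(** Continuity of [eta |-> g o eta] at [eta0] for the sup and L^2 norms; the
    common lower bound [m] on the derivatives makes the change of variables
    uniform in [eta]. *)
Lemma comp_close_of_vanishing g (eta0 : R -> R) (m : R) : inD eta0 -> 0 < m ->
  (forall x, m <= eta0^`() x) ->
  continuous g -> (sqint g < +oo)%E ->
  g x @[x --> -oo] --> (0 : R) -> g x @[x --> +oo] --> (0 : R) ->
  forall r : R, 0 < r -> exists2 d, 0 < d & forall eta, inD eta ->
    (forall x, m <= eta^`() x) -> (forall x, `|eta x - eta0 x| <= d) ->
    LinfL2_le r (fun x => g (eta x) - g (eta0 x)).
Proof.
move=> D0 m0 meta0 cg goo gNy gy r r0.
have [k k1 k2m] := exists_comp_factor m0.
have k0 : 0 < k by lra.
have s0 : 0 < r / 3 / k by rewrite !divr_gt0.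
(* Three pieces, [p o eta], [p o eta0] and the difference in [q], get [r / 3]
   each; composition costs a factor [k]. *)
have [t t0 ps] := exists_clamp_LinfL2_le cg goo s0.
have [M HM] : exists M, forall y, M < `|y| -> `|g y| <= t.
  move/cvgr0Pnorm_le : gNy => /(_ _ t0)[A [_ HA]].
  move/cvgr0Pnorm_le : gy => /(_ _ t0)[B [_ HB]].
  exists (Num.max (- A) B) => y; rewrite gt_max => /andP[Ay By].
  have [y0|y0] := leP 0 y; first by apply: HB; rewrite -(ger0_norm y0).
  by apply: HA; move: Ay; rewrite ltr0_norm // ltrN2.
pose p x := clamp t (g x); pose q x := g x - p x.
have cp : continuous p by exact: continuous_clamp.
have cq : continuous q by move=> x; apply: cvgB; [exact: cg|exact: cp].
have qM y : M < `|y| -> q y = 0.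
  by move=> /HM yt; rewrite /q /p clamp_id // subrr.
have r30 : 0 < r / 3 by lra.
have [d d0 Hd] := comp_close_of_compact_support D0 cq qM r30.
exists d => // eta Deta meta etad.
have pcomp h : inD h -> (forall x, m <= h^`() x) -> LinfL2_le (r / 3) (p \o h).
  move=> Dh mh; have := LinfL2_le_comp Dh m0 mh k1 k2m cp ps.
  by rewrite mulrC divfK // gt_eqF.
have ccomp f h : continuous f -> inD h -> continuous (f \o h).
  move=> cf /inD_continuous ch x.
  by apply: continuous_comp; [exact: ch|exact: cf].
have cqq : continuous (fun x => q (eta x) - q (eta0 x)).
  by move=> x; apply: cvgB; [exact: (ccomp q eta)|exact: (ccomp q eta0)].
have cN : continuous (\- (p \o eta0)).
  by move=> x; apply: cvgN; exact: (ccomp p eta0).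
have cpp : continuous ((p \o eta) \+ (\- (p \o eta0))).
  by move=> x; apply: cvgD; [exact: (ccomp p eta)|exact: cN].
have := LinfL2_le_add cpp cqq
  (LinfL2_le_add (ccomp _ _ cp Deta) cN (pcomp _ Deta meta)
    (LinfL2_le_opp (ccomp _ _ cp D0) (pcomp _ D0 meta0)))
  (Hd eta (inD_continuous Deta) etad).
have -> : r / 3 + r / 3 + r / 3 = r by lra.
rewrite (_ : _ \+ _ = fun x => g (eta x) - g (eta0 x)) //.
by apply/funext => x; rewrite /q /=; ring.
Qed.

(** * Continuity of the composition in both arguments *)

(** Telescoping that puts [eta'], not [eta0'], in the first two terms, so that
    only [xi0'] is evaluated at both [eta x] and [eta0 x]. *)
Lemma derive1_compB (xi xi0 eta eta0 : R -> R) :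
  inD xi -> inD xi0 -> inD eta -> inD eta0 ->
  ((xi \o eta) - (xi0 \o eta0))^`() =
  (fun x => (xi - xi0)^`() (eta x) * eta^`() x
    + (xi0^`() (eta x) - xi0^`() (eta0 x)) * eta^`() x
    + xi0^`() (eta0 x) * (eta - eta0)^`() x).
Proof.
move=> [[dxi _] _ _ _] [[dxi0 _] _ _ _] [[deta _] _ _ _] [[deta0 _] _ _ _].
apply/funext => x.
have dc (f h : R -> R) : (forall x, derivable f x 1) ->
    (forall x, derivable h x 1) -> derivable (f \o h) x 1.
  move=> df dh; apply/derivable1_diffP; apply: differentiable_comp;
    exact/derivable1_diffP.
have dcE (f h : R -> R) : (forall x, derivable f x 1) ->
    (forall x, derivable h x 1) -> (f \o h)^`() x = f^`() (h x) * h^`() x.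
  by move=> df dh; rewrite derive1_comp.
have dB (f h : R -> R) y : derivable f y 1 -> derivable h y 1 ->
    (f - h)^`() y = f^`() y - h^`() y.
  by move=> df dh; rewrite !derive1E; exact: deriveB.
rewrite (dB (xi \o eta)) ?(dB xi) ?(dB eta) ?(dcE xi) ?(dcE xi0) //; try exact: dc.
move: (xi^`() _) (xi0^`() _) (xi0^`() _) (eta^`() x) (eta0^`() x) => *.
ring.
Qed.

Lemma lipschitz_of_derive1 xi (b : R) : (forall x, derivable xi x 1) ->
  (forall x, `|xi^`() x| <= b) -> forall x y, `|xi x - xi y| <= b * `|x - y|.
Proof.
move=> dxi xib x y.
wlog xy : x y / x < y => [H|].
  have [| |->] := ltgtP x y; first exact: H.
    by move=> /H; rewrite distrC (distrC y).
  by rewrite !subrr normr0 mulr0.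
have [c e] := mvt dxi xy.
by rewrite distrC e normrM (distrC x) ler_wpM2r.
Qed.

Lemma inD_bounds (eta : R -> R) : inD eta ->
  exists a b : R, [/\ 0 < a, 0 < b & forall x, a <= eta^`() x <= b].
Proof. by move=> [_ [a [b [a0 [ab ?]]]] _ _]; exists a, b; split=> //; lra. Qed.

(** The theorem for the norm itself: the radius [r] may depend on [xi0] and
    [eta0], through the modulus of continuity of [xi0'] and the bounds on
    [eta0']. *)
Lemma comp_continuous_norm11 (xi0 eta0 : R -> R) : inD xi0 -> inD eta0 ->
  forall e : R, 0 < e -> exists2 r : R, 0 < r & forall xi eta : R -> R,
    inD xi -> inD eta -> (norm11 (xi - xi0)%R <= r%:E)%E ->
    (norm11 (eta - eta0)%R <= r%:E)%E ->
    (norm11 ((xi \o eta) - (xi0 \o eta0))%R <= e%:E)%E.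
Proof.
move=> Dxi0 Deta0 e e0.
have [? [b [? b0 xib]]] := inD_bounds Dxi0.
have [a [c [a0 c0 etaac]]] := inD_bounds Deta0.
(* [a / 2] and [c + 1] bound the derivative of every [eta] close to [eta0]. *)
have m0 : 0 < a / 2 by lra.
have [k k1 k2m] := exists_comp_factor m0.
have k0 : 0 < k by lra.
pose B := c + 1.
have B0 : 0 < B by rewrite /B; lra.
have [dxi0 cxi0 cxi0'] :
    [/\ forall x, derivable xi0 x 1, continuous xi0 & continuous xi0^`()].
  by case: (Dxi0) => -[? ?] _ _ _; split=> //; exact: derivable_cont.
have xi0'b x : `|xi0^`() x| <= b by rewrite ler_norml; have /andP[? ?] := xib x; lra.
pose g := xi0^`() - cst 1.
have [cg goo] : continuous g /\ (sqint g < +oo)%E.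
  by have [_ + _ _ +] := inD_C1H1 Dxi0; rewrite (derive1_subid dxi0).
have [gNy gy] : g x @[x --> -oo] --> (0 : R) /\ g x @[x --> +oo] --> (0 : R).
  have [_ _ _ [lNy ly]] := Dxi0.
  by split; rewrite -[X in _ --> X](subrr 1); apply: cvgB; do ?exact: cvg_cst.
have meta0 x : a / 2 <= eta0^`() x by have /andP[? _] := etaac x; lra.
have [T T0 ->] : exists2 T, 0 < T & e = 4 * T by exists (e / 4); lra.
have s0 : 0 < T / 2 / B by rewrite !divr_gt0.
have [d d0 Hd] := comp_close_of_vanishing Deta0 m0 meta0 cg goo gNy gy s0.
have N0 : 0 < B * k + b + k by rewrite !addr_gt0 ?mulr_gt0.
have TN0 : 0 < T / 2 / (B * k + b + k) by rewrite !divr_gt0.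
(* [d] serves the term in [g]; [a / 2] and [1] give the bounds on [eta'];
   the last bound makes [(B * k + b) * r] and [(k + b) * r] at most [T / 2]. *)
pose r := Num.min (Num.min d (a / 2)) (Num.min 1 (T / 2 / (B * k + b + k))).
have r0 : 0 < r by rewrite !lt_min d0 m0 ltr01 TN0.
have : r <= r by [].
rewrite {2}/r !le_min => /andP[/andP[rd ra] /andP[r1]].
rewrite ler_pdivlMr // => rN.
exists r => // xi eta Dxi Deta xir etar.
have [dw cw' _ _ _] := inD_C1H1B Dxi Dxi0.
have [dv cv' _ _ _] := inD_C1H1B Deta Deta0.
have cw := derivable_cont dw; have cv := derivable_cont dv.
have [wr w'r] := norm11_LinfL2_le xir.
have [vr v'r] := norm11_LinfL2_le etar.
have v'E x : (eta - eta0)^`() x = eta^`() x - eta0^`() x.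
  case: Deta Deta0 => -[deta _] _ _ _ [[deta0 _] _ _ _].
  by rewrite !derive1E; exact: deriveB.
have etaB x : a / 2 <= eta^`() x <= B.
  have [+ _] := v'r => /(_ x); rewrite v'E ler_norml => /andP[? ?].
  by have /andP[? ?] := etaac x; rewrite /B; apply/andP; split; lra.
have meta x : a / 2 <= eta^`() x by have /andP[] := etaB x.
have eta'B x : `|eta^`() x| <= B.
  by have /andP[? ?] := etaB x; rewrite ger0_norm //; lra.
have ceta := inD_continuous Deta; have ceta0 := inD_continuous Deta0.
have ceta' : continuous eta^`() by case: Deta => -[].
have cc (f h : R -> R) : continuous f -> continuous h -> continuous (f \o h).
  by move=> cf ch x; apply: continuous_comp; [exact: ch|exact: cf].
have cM (f h : R -> R) : continuous f -> continuous h -> continuous (fun x => f x * h x).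
  by move=> cf ch x; apply: cvgM; [exact: cf|exact: ch].
have cB (f h : R -> R) : continuous f -> continuous h -> continuous (fun x => f x - h x).
  by move=> cf ch x; apply: cvgB; [exact: cf|exact: ch].
have cD (f h : R -> R) : continuous f -> continuous h -> continuous (f \+ h).
  by move=> cf ch x; apply: cvgD; [exact: cf|exact: ch].
have compk f : continuous f -> LinfL2_le r f -> LinfL2_le (k * r) (f \o eta).
  by move=> cf; exact: LinfL2_le_comp m0 meta k1 k2m cf.
have Bkr0 : 0 < B * k * r by rewrite !mulr_gt0.
have br0 : 0 < b * r by rewrite mulr_gt0.
have kr0 : 0 < k * r by rewrite mulr_gt0.
apply: LinfL2_le_norm11.
- pose u x := xi0 (eta x) - xi0 (eta0 x).
  have cu : continuous u := cB _ _ (cc _ _ cxi0 ceta) (cc _ _ cxi0 ceta0).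
  have ub : LinfL2_le (b * r) u.
    apply: (LinfL2_le_dom cv cu (ltW b0)) vr => x.
    exact: lipschitz_of_derive1.
  have := LinfL2_le_add (cc _ _ cw ceta) cu (compk _ cw wr) ub.
  rewrite (_ : _ \+ _ = (xi \o eta) - (xi0 \o eta0)); last first.
    apply/funext => x; transitivity (xi (eta x) - xi0 (eta x) + u x) => //.
    by rewrite /u addrA subrK.
  by apply: LinfL2_leW; lra.
- rewrite (derive1_compB Dxi Dxi0 Deta Deta0).
  pose u1 x := (xi - xi0)^`() (eta x) * eta^`() x.
  pose u2 x := (xi0^`() (eta x) - xi0^`() (eta0 x)) * eta^`() x.
  pose u3 x := xi0^`() (eta0 x) * (eta - eta0)^`() x.
  have c1 : continuous u1 := cM _ _ (cc _ _ cw' ceta) ceta'.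
  have c20 := cB _ _ (cc _ _ cxi0' ceta) (cc _ _ cxi0' ceta0).
  have c2 : continuous u2 := cM _ _ c20 ceta'.
  have c3 : continuous u3 := cM _ _ (cc _ _ cxi0' ceta0) cv'.
  have u1r : LinfL2_le (B * (k * r)) u1.
    apply: (LinfL2_le_dom (cc _ _ cw' ceta) c1 (ltW B0)) (compk _ cw' w'r) => x.
    by rewrite /u1 normrM mulrC ler_wpM2r.
  have u2r : LinfL2_le (B * (T / 2 / B)) u2.
    have etad x : `|eta x - eta0 x| <= d.
      by have [/(_ x) + _] := vr => /le_trans; exact.
    apply: (LinfL2_le_dom _ c2 (ltW B0)) (Hd eta Deta meta etad) => [|x].
      exact: cB (cc _ _ cg ceta) (cc _ _ cg ceta0).
    rewrite /u2 normrM mulrC /g !fctE opprB addrA subrK ler_wpM2r //.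
  have u3r : LinfL2_le (b * r) u3.
    apply: (LinfL2_le_dom cv' c3 (ltW b0)) v'r => x.
    by rewrite /u3 normrM ler_wpM2r.
  have := LinfL2_le_add (cD _ _ c1 c2) c3 (LinfL2_le_add c1 c2 u1r u2r) u3r.
  apply: LinfL2_leW; rewrite (mulrC B (T / 2 / B)) divfK ?gt_eqF //; lra.
Qed.

End composition.

(* The product carries the product topology, [Dgroup R] that of [Ddist]. *)
Theorem corollary7 (R : realType) :
  continuous (@Dcomp R : (Dgroup R * Dgroup R)%type -> Dgroup R).
Proof.
move=> [xi0 eta0]; apply/cvg_ballP => e e0.
have e20 : 0 < e / 2 by lra.
have [r r0 Hr] := comp_continuous_norm11 (DfunP xi0) (DfunP eta0) e20.
have ballD (x y : Dgroup R) : ball x r y -> (norm11 (y \- x)%R <= r%:E)%E.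
  by rewrite ballEmdist /= => /ltW; rewrite -Ddist_EFin lee_fin Ddist_sym.
near=> p.
have [p1 p2] : ball xi0 r p.1 /\ ball eta0 r p.2.
  near: p; exists (ball xi0 r, ball eta0 r) => //=.
  by split; apply/nbhs_ballP; exists r.
have := Hr _ _ (DfunP p.1) (DfunP p.2) (ballD _ _ p1) (ballD _ _ p2).
rewrite ballEmdist /=.
have -> : mdist (Dcomp (xi0, eta0)) (Dcomp p) = Ddist (Dcomp p) (Dcomp (xi0, eta0)).
  exact: Ddist_sym.
move=> H; rewrite (@le_lt_trans _ _ (e / 2)) //; last by lra.
by rewrite -lee_fin Ddist_EFin.
Unshelve. all: by end_near. Qed.
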